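(* Let $k\ge 2$ and let $u$ be an oriented word of rank $k$. The relation $\leq_u$ on $F_k$ defined by $$g\leq_u h \quad\text{if and only if}\quad \tau_u(g^{-1}h)\ge 0$$ is a left order on $F_k$ with positive cone $P_u=\{g\in F_k\mid \tau_u(g)>0\}$.
   Context: Let $k\ge 2$ and let $\mathcal{A}=\{a_1,\dots,a_k\}$ be a basis of the free group $F_k$. For $a\in\mathcal{A}$ the inverse is denoted by the corresponding uppercase letter ($A=a^{-1}$, $B=b^{-1}$, $A_i=a_i^{-1}$). Letters in $\mathcal{A}$ are called positive (lowercase), letters in $\mathcal{A}^{-1}$ negative (uppercase), and $\mathcal{A}^{\pm}=\mathcal{A}\cup\mathcal{A}^{-1}$. Elements of $F_k$ are identified with reduced group words over $\mathcal{A}^\pm$; $e$ is the trivial element. An oriented word of rank $k$ is a word of length $2k$ over $\mathcal{A}^\pm$ containing each letter of $\mathcal{A}^\pm$ exactly once. For distinct $x,y\in\mathcal{A}^\pm$, ''$x..y$ in $u$'' means that $x$ is to the left of $y$ in $u$. $\#_w(g)$ is the number of (possibly overlapping) occurrences of $w$ as a contiguous subword of $g$. For an oriented word $u$ of rank $k$ and a reduced word $g$, define $$\alpha_u(g)=\sum_{a,b\in\mathcal{A},\ A..B\text{ in }u}\#_{aB}(g)-\sum_{a,b\in\mathcal{A},\ a..b\text{ in }u}\#_{Ba}(g),$$ $$\beta_u(g)=\sum_{a,b\in\mathcal{A},\ A..b\text{ in }u}\#_{ab}(g)-\sum_{a,b\in\mathcal{A},\ A..b\text{ in }u}\#_{BA}(g)$$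 (sums over ordered pairs $(a,b)$; in $\beta_u$ the case $a=b$ is allowed), and let $\omega(g)=\frac12$ if the last letter of $g$ is in $\mathcal{A}$, $\omega(g)=-\frac12$ if it is in $\mathcal{A}^{-1}$, $\omega(e)=0$. The weight induced by $u$ is $\tau_u=\alpha_u+\beta_u+\omega$ (always evaluated on reduced forms). A left order on a group $G$ is a linear (total) order $\le$ on $G$ such that $g\le h$ implies $fg\le fh$ for all $f,g,h\in G$; its positive cone is $\{g\in G\mid e<g\}$. *)

(* Defs.v *)
(* The free group of rank k is realised as the group of reduced words, the
   product of two words being the reduced form of their concatenation. *)
From HB Require Import structures.
From mathcomp Require Import all_boot all_order all_algebra.

Set Implicit Arguments.
Unset Strict Implicit.
Unset Printing Implicit Defensive.

(* (i, true) is the basis element a_i and (i, false) its inverse A_i. *)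
Notation letter k := ('I_k * bool)%type.

Section Words.
Variable k : nat.
Implicit Types (a b : 'I_k) (x y : letter k) (s t : seq (letter k)).

Definition pos a : letter k := (a, true).
Definition neg a : letter k := (a, false).
Definition inv_letter x : letter k := (x.1, ~~ x.2).

Lemma inv_letterK : involutive inv_letter.
Proof. by case=> a b; rewrite /inv_letter /= negbK. Qed.

Definition reduced s := sorted (fun x y => y != inv_letter x) s.

(* On a reduced word s, the reduced form of x :: s. *)
Definition cons_red x s :=
  if s is y :: s' then if y == inv_letter x then s' else x :: s else [:: x].

Definition reduce s := foldr cons_red [::] s.
Definition inv_word s := rev (map inv_letter s).

Lemma cons_red_reduced x s : reduced s -> reduced (cons_red x s).
Proof.
case: s => [|y s] //= rs; case: ifP => [_|/negbT nxy]; last by rewrite /= nxy.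
exact: path_sorted rs.
Qed.

Lemma foldr_reduced s t : reduced t -> reduced (foldr cons_red t s).
Proof. by move=> rt; elim: s => //= x s; apply: cons_red_reduced. Qed.

Lemma reduce_reduced s : reduced (reduce s).
Proof. exact: foldr_reduced. Qed.

Lemma reduce_id s : reduced s -> reduce s = s.
Proof.
elim: s => //= x s IHs rs; rewrite IHs; last exact: path_sorted rs.
by case: s rs {IHs} => //= y s /andP[/negbTE ->].
Qed.

Lemma cons_redK x s : reduced s -> cons_red (inv_letter x) (cons_red x s) = s.
Proof.
case: s => [|y s] /=; first by rewrite inv_letterK eqxx.
case: (eqVneq y (inv_letter x)) => [-> | _ _]; last by rewrite /= inv_letterK eqxx.
by case: s => [|z s] //= /andP[/negbTE->].
Qed.

Lemma foldr_cons_red x s t : reduced s -> reduced t ->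
  foldr cons_red t (cons_red x s) = cons_red x (foldr cons_red t s).
Proof.
move=> rs rt; case: s rs => [|y s] //= _.
case: eqP => //= ->; have := cons_redK (inv_letter x) (foldr_reduced s rt).
by rewrite inv_letterK => ->.
Qed.

Lemma foldr_reduce s t : reduced t -> foldr cons_red t (reduce s) = foldr cons_red t s.
Proof.
by move=> rt; elim: s => //= x s IHs; rewrite foldr_cons_red ?reduce_reduced // IHs.
Qed.

Lemma reduce_catl s t : reduce (reduce s ++ t) = reduce (s ++ t).
Proof. by rewrite /reduce !foldr_cat foldr_reduce ?reduce_reduced. Qed.

Lemma reduce_catr s t : reduce (s ++ reduce t) = reduce (s ++ t).
Proof. by rewrite /reduce !foldr_cat -/(reduce _) reduce_id ?reduce_reduced. Qed.

Lemma inv_word_reduced s : reduced s -> reduced (inv_word s).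
Proof.
rewrite /reduced /inv_word rev_sorted sorted_map; apply: sub_sorted => x y /=.
by apply: contraNN => /eqP xy; apply/eqP; rewrite xy inv_letterK.
Qed.

Lemma inv_wordK : involutive inv_word.
Proof.
move=> s; rewrite /inv_word map_rev revK -map_comp -[RHS]map_id.
by apply: eq_map => x; apply: inv_letterK.
Qed.

Lemma reduce_catV s : reduce (s ++ inv_word s) = [::].
Proof.
elim: s => //= x s IHs; rewrite /inv_word /= rev_cons -/(inv_word s) -cats1 catA.
by rewrite -reduce_catl IHs /= eqxx.
Qed.

End Words.

Record free_group (k : nat) :=
  FreeWord { fword :> seq (letter k); fwordP : reduced fword }.
HB.instance Definition _ k := [isSub for @fword k].
HB.instance Definition _ k := [Countable of free_group k by <:].

Section FreeGroup.
Variable k : nat.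
Implicit Types g h : free_group k.

Definition free_one : free_group k := @FreeWord k [::] isT.
Definition free_mul g h := FreeWord (reduce_reduced (fword g ++ fword h)).
Definition free_inv g := FreeWord (inv_word_reduced (fwordP g)).

Lemma free_mulA : associative free_mul.
Proof. by move=> f g h; apply: val_inj; rewrite /= reduce_catl reduce_catr catA. Qed.

Lemma free_mul1 : left_id free_one free_mul.
Proof. by move=> g; apply: val_inj; rewrite /= reduce_id ?fwordP. Qed.

Lemma free_mulr1 : right_id free_one free_mul.
Proof. by move=> g; apply: val_inj; rewrite /= cats0 reduce_id ?fwordP. Qed.

Lemma free_mulV : right_inverse free_one free_inv free_mul.
Proof. by move=> g; apply: val_inj; rewrite /= reduce_catV. Qed.

Lemma free_mulVl : left_inverse free_one free_inv free_mul.
Proof.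
by move=> g; apply: val_inj; rewrite /= -{2}[fword g]inv_wordK reduce_catV.
Qed.

HB.instance Definition _ := isGroup.Build (free_group k)
  free_mulA free_mul1 free_mulr1 free_mulVl free_mulV.

End FreeGroup.

Section Orders.
Variable G : groupType.
Implicit Type le : rel G.

Definition linear_order le :=
  [/\ reflexive le, antisymmetric le, transitive le & total le].

Definition left_order le :=
  linear_order le /\ (forall f g h : G, le g h -> le (f * g)%g (f * h)%g).

Definition positive_cone le : {pred G} := [pred g | le 1%g g && (g != 1%g)].

End Orders.

Section Weight.
Variable k : nat.
Implicit Types (u s w : seq (letter k)) (x y : letter k) (g h : free_group k).

Definition oriented_word u :=
  size u = k.*2 /\ (forall x, count_mem x u = 1%N).

(* Meaningful for words u containing each letter exactly once. As left_of u x x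
   is false, the two sums of alpha below only range over pairs with a != b. *)
Definition left_of u x y : bool := (index x u < index y u)%N.

Definition occ w s : nat := count (fun i => prefix w (drop i s)) (iota 0 (size s).+1).

Local Open Scope ring_scope.

Definition alpha u s : rat :=
  \sum_(a : 'I_k) \sum_(b : 'I_k | left_of u (neg a) (neg b))
     (occ [:: pos a; neg b] s)%:R
  - \sum_(a : 'I_k) \sum_(b : 'I_k | left_of u (pos a) (pos b))
     (occ [:: neg b; pos a] s)%:R.

Definition beta u s : rat :=
  \sum_(a : 'I_k) \sum_(b : 'I_k | left_of u (neg a) (pos b))
     (occ [:: pos a; pos b] s)%:R
  - \sum_(a : 'I_k) \sum_(b : 'I_k | left_of u (neg a) (pos b))
     (occ [:: neg b; neg a] s)%:R.

Definition omega s : rat :=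
  if rev s is x :: _ then (if x.2 then 1 / 2 else - (1 / 2)) else 0.

Definition tau u g : rat := alpha u g + beta u g + omega g.

Definition le_word u : rel (free_group k) := fun g h => 0 <= tau u (g^-1 * h)%g.

Definition P_word u : {pred free_group k} := [pred g | 0 < tau u g].

End Weight.

(* Main.v *)
Require Import Defs.
From mathcomp Require Import all_boot all_order all_algebra.
From mathcomp Require Import zify lra.

(** Comparing the four sums of [tau] letter by letter shows that an adjacent
    pair [x y] of a reduced word contributes
    [(sign x + side (x^-1) y) / 2], where [side p q] is [1] or [-1] according
    to whether [p] lies to the left or to the right of [q] in [u]
    ([alpha_beta_omega]).  Hence twice the weight of [x_1 ... x_n] is the integer
      [sum_i sign x_i + sum_(i < n) side (x_i^-1) x_(i+1)],
    called [weight] below.  Everything follows from this formula.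

    It has [2n - 1] terms, all equal to [1] or [-1], so it is odd, and in
    particular nonzero, for [n > 0] ([odd_weight]).  As [sign] is odd under
    inversion and [side] is antisymmetric, the weight changes sign under
    inversion ([weight_inv]).

    Finally, the weight is a quasimorphism with defect [1] ([weight_mul]).
    Write [g = p r] and [h = r^-1 q] where [r] is the part that cancels in
    [g h], so that [p q] is reduced.  The contributions of [p], [q] and [r]
    cancel in [weight g + weight h - weight (g h)], and only the junctions
    remain:
      [side P R + side R Q - side P Q],
    with [P] the inverse of the last letter of [p], and [R], [Q] the first
    letters of [r], [q].  Since [side] compares points of a line, this
    expression is at most [1] in absolute value.  If [g] and [h] have positive
    weight then these weights are at least [1], so [g h] has weight at least
    [1 + 1 - 1 > 0]: the elements of positive weight form a semigroup, which
    with its inverse and the identity partitions the group. *)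

Set Implicit Arguments.
Unset Strict Implicit.
Unset Printing Implicit Defensive.

Import Order.TTheory GRing.Theory Num.Theory.
Local Open Scope ring_scope.

(** * Twice the weight, as an integer *)

Section IntegerWeight.
Variables (k : nat) (u : seq (letter k)).
Implicit Types (x y : letter k) (s t : seq (letter k)).
Implicit Types (a b c : option (letter k)).

Definition sign x : int := if x.2 then 1 else -1.

(** The two sides are optional letters so that an empty word on either side of a
    junction contributes nothing. *)
Definition side a b : int :=
  if a is Some x then
    if b is Some y then if left_of u x y then 1 else -1 else 0
  else 0.

Definition apart a b : bool :=
  if a is Some x then if b is Some y then x != y else true else true.

Fixpoint weight s : int :=
  if s is x :: s' then
    sign x + side (Some (inv_letter x)) (ohead s') + weight s'
  else 0.

Lemma inv_word_cons x s : inv_word (x :: s) = inv_word s ++ [:: inv_letter x].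
Proof. by rewrite /inv_word /= rev_cons cats1. Qed.

Lemma inv_word_rcons s x : inv_word (rcons s x) = inv_letter x :: inv_word s.
Proof. by rewrite /inv_word map_rcons rev_rcons. Qed.

Lemma ohead_inv_word_cons2 x y s :
  ohead (inv_word [:: x, y & s]) = ohead (inv_word (y :: s)).
Proof. by rewrite inv_word_cons inv_word_cons; case: (inv_word s). Qed.

(** Expressing the condition at the junction through [inv_word s] puts it in the
    same terms as [weight_cat], so that it feeds [side_antisym] directly. *)
Lemma reduced_cat s t :
  reduced (s ++ t) =
  [&& reduced s, reduced t & apart (ohead (inv_word s)) (ohead t)].
Proof.
elim: s => [|x [|y s] IHs] /=; first by rewrite andbT.
  by case: t {IHs} => //= y t; rewrite eq_sym andbC.
by rewrite ohead_inv_word_cons2 /reduced /= in IHs *; rewrite IHs !andbA.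
Qed.

Lemma weight_cat s t :
  weight (s ++ t) = weight s + weight t + side (ohead (inv_word s)) (ohead t).
Proof.
elim: s => [|x [|y s] IHs] /=; first by rewrite add0r addr0.
  by rewrite !addr0 addrAC.
by rewrite ohead_inv_word_cons2 /= in IHs *; rewrite IHs; lia.
Qed.

(** A word of length [n] has [n] signs and [n - 1] sides, all odd. *)
Lemma odd_weight s : s != [::] -> exists m : int, weight s = 2 * m + 1.
Proof.
elim: s => // x [|y s] IHs _.
  by rewrite /= /sign; case: x.2; [exists 0 | exists (-1)].
have [//|m Em] := IHs; rewrite -cat1s weight_cat Em /= /sign.
case: x.2; case: ifP => _.
- by exists (m + 1); lia.
- by exists m; lia.
- by exists m; lia.
- by exists (m - 1); lia.
Qed.

Section Oriented.
Hypothesis hu : oriented_word u.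

Lemma index_oriented_inj : injective (index^~ u).
Proof.
case: hu => _ cu x y exy; apply: (index_inj x) (exy);
  by rewrite -has_pred1 has_count cu.
Qed.

Lemma left_ofC x y : x != y -> left_of u y x = ~~ left_of u x y.
Proof.
move=> nxy; rewrite /left_of -leqNgt ltn_neqAle andb_idl // => _.
by apply: contraNneq nxy => /index_oriented_inj->.
Qed.

Lemma side_antisym a b : apart a b -> side a b = - side b a.
Proof. by case: a b => [x|] [y|] //= /left_ofC->; case: left_of. Qed.

(** By transitivity, [side] cannot go forward from [a] to [b] and from [b] to
    [c] and yet backward from [a] to [c], nor the other way around. *)
Lemma side_cocycle a b c : `|side a b + side b c - side a c| <= 1.
Proof.
case: a b c => [x|] [y|] [z|] //=; rewrite /left_of.
- case: (ltnP (index x u)) => xy; case: (ltnP (index y u)) => yz //.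
  + by rewrite (ltn_trans xy yz).
  + by case: ifP.
  + by case: ifP.
  + by rewrite ltnNge (leq_trans yz xy).
all: by case: ifP.
Qed.

(** Inversion flips every sign, and it exchanges the two arguments of every side:
    the junction [x y] becomes [y^-1 x^-1], of side [side y (x^-1)]. *)
Lemma weight_inv s : reduced s -> weight (inv_word s) = - weight s.
Proof.
elim: s => // x s IHs; rewrite -cat1s reduced_cat => /and3P[_ rs xs].
rewrite inv_word_cons !weight_cat IHs // inv_wordK (side_antisym xs) /=.
by rewrite /sign /=; case: x.2 => /=; lia.
Qed.

(** Strip matching letters from the end of [s] and the start of [t] for as long
    as the junction is not reduced; [r] collects what was stripped. *)
Lemma cancellation s t : reduced s -> reduced t ->
  exists p r q, [/\ s = p ++ r, t = inv_word r ++ q & reduced (p ++ q)].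
Proof.
elim/last_ind: s t => [|s x IHs] t rs rt; first by exists [::], [::], t.
case: (boolP (reduced (rcons s x ++ t))) => [rst | ].
  by exists (rcons s x), [::], t; rewrite cats0.
rewrite reduced_cat rs rt inv_word_rcons /=.
case: t rt => //= y t rt /negPn/eqP <-.
move: rs; rewrite -cats1 reduced_cat => /and3P[rs _ _].
have [p [r [q [-> -> rpq]]]] := IHs _ rs (path_sorted rt).
by exists p, (rcons r x), q; rewrite inv_word_rcons -cats1 catA.
Qed.

(** The weights of [r] and of its inverse cancel, which leaves three junctions
    forming an instance of [side_cocycle]. *)
Lemma weight_mul (g h : free_group k) :
  `|weight g + weight h - weight (g * h)%g| <= 1.
Proof.
have [p [r [q [Eg Eh rpq]]]] := cancellation (fwordP g) (fwordP h).
have -> : fword (g * h)%g = p ++ q.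
  transitivity (reduce (g ++ h)); first by [].
  rewrite Eg Eh -catA -reduce_catr (catA r) -(reduce_catl (r ++ _)) reduce_catV.
  by rewrite reduce_catr reduce_id.
have := side_cocycle (ohead (inv_word p)) (ohead r) (ohead q).
have : reduced r by move: (fwordP g); rewrite Eg reduced_cat => /and3P[].
rewrite Eg Eh !weight_cat inv_wordK => /weight_inv->.
by congr (`| _ | <= _); lia.
Qed.

End Oriented.
End IntegerWeight.

(** * From letter pairs to the weight of an oriented word *)

Section Tau.
Variables (k : nat) (u : seq (letter k)).
Hypothesis hu : oriented_word u.
Implicit Types (x y : letter k) (s w : seq (letter k)) (g h : free_group k).

Lemma occ_cons w x s : occ w (x :: s) = (prefix w (x :: s) + occ w s)%N.
Proof.
rewrite -[LHS]/(prefix w (x :: s) + count _ (iota 1 (size s).+1))%N.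
by rewrite (iotaDl 1 0) count_map.
Qed.

(** All four sums of [alpha] and [beta] are of this form, those over [B a] and
    [B A] after exchanging the two summations. *)
Definition pair_count (e f : bool) (P : rel 'I_k) s : rat :=
  \sum_(a : 'I_k) \sum_(b : 'I_k | P a b) (occ [:: (a, e); (b, f)] s)%:R.

Lemma pair_count_swap e f (P : rel 'I_k) s :
  \sum_(a : 'I_k) \sum_(b : 'I_k | P a b) (occ [:: (b, e); (a, f)] s)%:R
  = pair_count e f (fun b a => P a b) s.
Proof. by rewrite (exchange_big_dep xpredT). Qed.

Lemma pair_count_small e f P s : (size s <= 1)%N -> pair_count e f P s = 0.
Proof.
move=> ss; rewrite /pair_count big1 // => a _; rewrite big1 // => b _.
by case: s ss => [|x [|y s]] //= _; rewrite /occ /= ?andbF.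
Qed.

Lemma pair_count_cons2 e f P x y s :
  pair_count e f P [:: x, y & s] =
  [&& x.2 == e, y.2 == f & P x.1 y.1]%:R + pair_count e f P (y :: s).
Proof.
rewrite /pair_count.
under eq_bigr => a _ do under eq_bigr => b _ do rewrite occ_cons natrD.
under eq_bigr => a _ do rewrite big_split /=.
rewrite big_split /=; congr (_ + _).
rewrite (bigD1 x.1) //= [X in _ + X]big1 ?addr0 => [|a /negbTE nax]; last first.
  by rewrite big1 // => b _; rewrite -pair_eqE /= nax.
rewrite big_mkcond (bigD1 y.1) //= [X in _ + X]big1 ?addr0 => [|b /negbTE nby].
  case: x y => [a e'] [b f'] /=; rewrite -!pair_eqE /= !eqxx !andTb prefix0s andbT.
  by rewrite (eq_sym e) (eq_sym f); case: (P a b); rewrite ?andbT ?andbF.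
by case: ifP => // _; rewrite -!pair_eqE /= nby andbF.
Qed.

Lemma omega_cons2 x y s : omega [:: x, y & s] = omega (y :: s).
Proof. by rewrite /omega !rev_cons; case: (rev s). Qed.

(** At a pair [x y], a positive [x] contributes [1] if [x^-1] is to the left of
    [y] and [0] otherwise; a negative [x] contributes [-1] if [y] is to the left
    of [x^-1] and [0] otherwise.  As [s] is reduced, [y] and [x^-1] are distinct,
    so both are half of [sign x] plus half of the side of the pair.  The last
    letter is in no pair as [x]; its half sign is [omega]. *)
Lemma alpha_beta_omega s : reduced s ->
  alpha u s + beta u s + omega s = (weight u s)%:~R / 2.
Proof.
rewrite /alpha /beta !pair_count_swap -!/(pair_count _ _ _ _).
elim: s => [|x [|y s] IHs] rs.
- by rewrite !pair_count_small // /omega /= mul0r; lra.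
- by rewrite !pair_count_small // /omega /= /sign !addr0; case: x.2; lra.
move: rs; rewrite -cat1s reduced_cat => /and3P[_ /IHs{}IHs xy].
rewrite !pair_count_cons2 omega_cons2 weight_cat rmorphD rmorphD /= mulrDl mulrDl.
rewrite -{}IHs /=; have := left_ofC hu xy.
move: x y xy => [a e] [b f] /= _; rewrite /sign /pos /neg /inv_letter.
by case: e f => [] [] /= leftC; rewrite ?leftC; case: left_of => /=; lra.
Qed.

Lemma tauE g : tau u g = (weight u g)%:~R / 2.
Proof. exact/alpha_beta_omega/fwordP. Qed.

Lemma tau_ge0 g : (0 <= tau u g) = (0 <= weight u g).
Proof. by rewrite tauE pmulr_lge0 ?ler0z // invr_gt0. Qed.

Lemma tau_gt0 g : (0 < tau u g) = (0 < weight u g).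
Proof. by rewrite tauE pmulr_lgt0 ?ltr0z // invr_gt0. Qed.

Lemma weight_free_inv g : weight u (g^-1)%g = - weight u g.
Proof. exact: weight_inv hu _ (fwordP g). Qed.

Lemma weight_eq0 g : (weight u g == 0) = (g == 1%g).
Proof.
apply/eqP/eqP => [wg | ->] //; apply: val_inj; apply/eqP/negPn/negP.
by move=> /(odd_weight u)[m]; rewrite wg; lia.
Qed.

(** A nontrivial element of nonnegative weight has weight at least [1], which
    makes up for the defect of [weight_mul]. *)
Lemma weight_mul_ge0 g h :
  0 <= weight u g -> 0 <= weight u h -> 0 <= weight u (g * h)%g.
Proof.
have [-> | ] := eqVneq g 1%g; first by rewrite mul1g.
have [-> | ] := eqVneq h 1%g; first by rewrite mulg1.
rewrite -!weight_eq0; have := weight_mul hu g h.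
move: (weight u g) (weight u h) (weight u (g * h)%g) => a b c; lia.
Qed.

End Tau.

(** * The left order *)

Theorem theorem2 (k : nat) (hk : (2 <= k)%N) (u : seq (letter k))
    (hu : oriented_word u) :
  left_order (le_word u) /\ positive_cone (le_word u) =i P_word u.
Proof.
have leE (g h : free_group k) : le_word u g h = (0 <= weight u (g^-1 * h)%g).
  exact: tau_ge0.
have geE (g h : free_group k) : le_word u h g = (weight u (g^-1 * h)%g <= 0).
  (* The weight changes sign when the quotient is inverted. *)
  rewrite leE; have <- : ((g^-1 * h)^-1 = h^-1 * g)%g by rewrite invgM invgK.
  by rewrite weight_free_inv // oppr_ge0.
have le_refl : reflexive (le_word u) by move=> g; rewrite leE mulVg.
have le_anti : antisymmetric (le_word u).
  move=> g h; rewrite leE geE andbC -eq_le weight_eq0.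
  by move=> /eqP gh1; rewrite -(mulg1 g) -gh1 mulVKg.
have le_tr : transitive (le_word u).
  move=> h g f; rewrite !leE => gh hf.
  by have := weight_mul_ge0 hu gh hf; rewrite -mulgA mulVKg.
have le_tot : total (le_word u) by move=> g h; rewrite leE geE le_total.
have le_mul (f g h : free_group k) :
  le_word u g h -> le_word u (f * g)%g (f * h)%g.
  by rewrite !leE invgM -mulgA mulKg.
have coneE (g : free_group k) : (g \in positive_cone (le_word u)) = (0 < tau u g).
  by rewrite inE leE invg1 mul1g tau_gt0 // lt0r weight_eq0 andbC.
by split; last exact: coneE.
Qed.
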